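(* Let $\mathbb{S}$ be an idempotent semifield, $V\cong\mathbb{S}^n$ a free $\mathbb{S}$-module with basis $e_1,\dots,e_n$, $G$ a finite group, and $G\to\mathrm{GL}(V)$ a linear representation. Let $\langle-,-\rangle$ be the standard inner product on $V$. Then $$\langle-,-\rangle_G:=\sum_{g\in G}\langle g\cdot-,g\cdot-\rangle$$ is a non-degenerate symmetric bilinear form on $V$. If moreover $\mathbb{S}$ is totally ordered and $T\subseteq V$ is a tropical subrepresentation, then the isomorphism $V^\vee\cong V$ induced by $\langle-,-\rangle_G$ sends the orthogonal dual $T^\perp\subseteq V^\vee$ to a tropical subrepresentation of $V$.
   Context: An idempotent semifield $\mathbb{S}$ is a commutative semiring satisfying all field axioms except existence of additive inverses, with $s+s=s$ for all $s$; it is partially ordered by $a\le b\Leftrightarrow a+b=b$, and ''totally ordered'' refers to this order. $V^\vee=\mathrm{Hom}(V,\mathbb{S})$ has dual basis $x_1,\dots,x_n$. A linear representation is a group homomorphism $G\to\mathrm{GL}(V)$; every element of $\mathrm{GL}(V)$ is given by a monomial matrix. The standard inner product is $\langle\sum v_ie_i,\sum w_ie_i\rangle=\sum v_iw_i$. A symmetric bilinear form on $V$ is non-degenerate if the induced linear map $V\to V^\vee$, $v\mapsto\langle v,-\rangle$, is an isomorphism; the induced isomorphism $V^\vee\cong V$ is the inverse of this map. Exterior powers: $\bigwedge V$ is the quotient of the symmetric algebra of $V$ by the congruence generated by $e_i^2\sim0$; $\bigwedge^dV$ is free with basis $e_I=e_{i_1}\wedge\cdots\wedge e_{i_d}$,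 $I\in\binom{[n]}{d}$. A rank $d$ tropical Plücker vector is a nonzero $v=\sum v_Ie_I\in\bigwedge^dV$ such that $\sum_{i\in A\setminus B}v_{A\setminus i}v_{B\cup i}=\sum_{i\in(A\setminus B)\setminus j}v_{A\setminus i}v_{B\cup i}$ for all $A\in\binom{[n]}{d+1}$, $B\in\binom{[n]}{d-1}$, $j\in A\setminus B$. The tropical hyperplane in $V$ defined by $\sum a_ix_i$ is the set of $p=\sum p_ie_i$ with $\sum_ia_ip_i=\sum_{i\neq j}a_ip_i$ for every $j$. The tropical linear space $T_v\subseteq V$ is the intersection over $A\in\binom{[n]}{d+1}$ of the tropical hyperplanes defined by $\sum_{i\in A}v_{A\setminus i}x_i$; a tropical linear space is a submodule of the form $T_v$. A tropical subrepresentation of $V$ is a $G$-invariant tropical linear space $T\subseteq V$. The orthogonal dual $T^\perp\subseteq V^\vee$ is the intersection of the tropical hyperplanes in $V^\vee$ defined by the elements of $T$, viewed as linear forms on $V^\vee$ via $V\cong V^{\vee\vee}$. *)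

(* Defs.v *)
From HB Require Import structures.
From mathcomp Require Import all_boot all_order all_algebra all_fingroup.
From mathcomp Require Import boolp classical_sets.

Set Implicit Arguments.
Unset Strict Implicit.
Unset Printing Implicit Defensive.

Import GRing.Theory.
Local Open Scope classical_set_scope.
Local Open Scope ring_scope.

(* Commutativity, [1 != 0] and [0 * s = 0] are part of [comNzSemiRingType]. *)
Definition idempotent_semifield (S : comNzSemiRingType) : Prop :=
  (forall s : S, s != 0 -> exists t : S, s * t = 1) /\
  (forall s : S, s + s = s).

Definition semifield_le (S : comNzSemiRingType) (a b : S) : Prop := a + b = b.

Definition totally_ordered (S : comNzSemiRingType) : Prop :=
  forall a b : S, semifield_le a b \/ semifield_le b a.

(* Only the two homomorphism laws are needed: they make each [rho g] a linear
   bijection, i.e. an element of GL(V). *)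
Definition is_representation (S : comNzSemiRingType) (V : lSemiModType S)
    (G : finGroupType) (rho : G -> {linear V -> V}) : Prop :=
  (forall v, rho 1%g v = v) /\
  (forall g h v, rho (g * h)%g v = rho g (rho h v)).

(* The dual module V^\vee = Hom(V, S) is the type {scalar V}. *)
Record bilinear_form (S : comNzSemiRingType) (V : lSemiModType S) :=
  BilinearForm {
    bform :> V -> V -> S;
    bform_linear_r : forall v, semiscalar (bform v);
    bform_linear_l : forall w, semiscalar (bform^~ w)
  }.

HB.instance Definition _ (S : comNzSemiRingType) (V : lSemiModType S)
    (b : bilinear_form V) (v : V) :=
  GRing.isSemilinear.Build S V S *%R (bform b v) (bform_linear_r b v).

(* v |-> <v, -> is linear in v by [bform_linear_l]; hence it is an isomorphism
   of semimodules as soon as it is bijective. *)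
Definition induced_map (S : comNzSemiRingType) (V : lSemiModType S)
    (b : bilinear_form V) (v : V) : {scalar V} := bform b v.

Definition form_symmetric (S : comNzSemiRingType) (V : lSemiModType S)
    (b : bilinear_form V) : Prop := forall v w, b v w = b w v.

Definition form_nondegenerate (S : comNzSemiRingType) (V : lSemiModType S)
    (b : bilinear_form V) : Prop := bijective (induced_map b).

Section Basis.
Variables (S : comNzSemiRingType) (V : lSemiModType S) (n : nat).
Variable e : 'I_n -> V.

Definition is_basis : Prop :=
  forall v : V, exists! c : {ffun 'I_n -> S}, v = \sum_i c i *: e i.

(* The coordinates of [v] in the basis [e]; the default value is irrelevant
   when [is_basis] holds. *)
Definition basis_coord (v : V) : {ffun 'I_n -> S} :=
  xget [ffun=> 0] [set c | v = \sum_i c i *: e i].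

Definition std_inner (v w : V) : S := \sum_i basis_coord v i * basis_coord w i.

Definition averaged_inner (G : finGroupType) (rho : G -> {linear V -> V})
    (v w : V) : S := \sum_(g : G) std_inner (rho g v) (rho g w).

(* Tropical hyperplane with coefficients [a], as a set of coordinate vectors;
   it is used both for V (basis e) and for V^\vee (dual basis). *)
Definition trop_hyperplane (a : 'I_n -> S) : set ('I_n -> S) :=
  [set p | forall j, \sum_i a i * p i = \sum_(i | i != j) a i * p i].

(* An element of the exterior algebra of V is written in its basis (e_I)_I,
   I ranging over all subsets of [n]. It lies in the d-th exterior power iff
   its coefficients vanish outside the d-subsets. *)
Definition in_exterior_power (d : nat) (v : {ffun {set 'I_n} -> S}) : Prop :=
  forall I : {set 'I_n}, #|I| <> d -> v I = 0.

(* [#|B|.+1 = d] rather than [#|B| = d.-1]: there is no such B when d = 0. *)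
Definition plucker_vector (d : nat) (v : {ffun {set 'I_n} -> S}) : Prop :=
  [/\ in_exterior_power d v,
      (exists I, v I != 0) &
      forall (A B : {set 'I_n}) (j : 'I_n),
        #|A| = d.+1 -> #|B|.+1 = d -> j \in A :\: B ->
        \sum_(i in A :\: B) v (A :\ i) * v (i |: B) =
        \sum_(i in (A :\: B) :\ j) v (A :\ i) * v (i |: B)].

Definition trop_linear_space_of (d : nat) (v : {ffun {set 'I_n} -> S}) :
    set V :=
  [set p | forall A : {set 'I_n}, #|A| = d.+1 ->
     trop_hyperplane (fun i => if i \in A then v (A :\ i) else 0)
                     (basis_coord p)].

(* [trop_linear_space_of d v] is always a subsemimodule of V. *)
Definition trop_linear_space (T : set V) : Prop :=
  exists (d : nat) (v : {ffun {set 'I_n} -> S}),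
    plucker_vector d v /\ T = trop_linear_space_of d v.

Definition trop_subrepresentation (G : finGroupType)
    (rho : G -> {linear V -> V}) (T : set V) : Prop :=
  trop_linear_space T /\ (forall (g : G) (p : V), T p -> T (rho g p)).

(* Evaluation at p is the linear form on V^\vee with coefficients
   [basis_coord p], and f has coordinates f(e_i) in the dual basis. *)
Definition orthogonal_dual (T : set V) : set {scalar V} :=
  [set f | forall p, T p -> trop_hyperplane (basis_coord p) (fun i => f (e i))].

End Basis.

(* Main.v *)
(* Idempotent semifields have no zero divisors and no nontrivial vanishing sums,
   so every rho g is monomial and the averaged form is diagonal with nonzero
   entries delta_i = sum_g c_g(i)^2.  Under psi the dual of T = T_v becomes the
   set of w such that sum_i delta_i p_i w_i vanishes tropically for all p in T;
   it is invariant because the form is.  It is also the tropical linear space of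
   v'_I = v_{~I} prod_{i notin I} delta_i: the only point is that orthogonality
   to all cocircuits i |-> v_{B u i} implies orthogonality to all of T_v, which
   holds because below each p in T_v there is, for each j in the support of p,
   a multiple of a cocircuit agreeing with p at j. *)

Require Import Defs.
From mathcomp Require Import all_boot all_order all_algebra all_fingroup.
From mathcomp Require Import boolp classical_sets.
From mathcomp Require Import zify ring fintype finset.

Set Implicit Arguments.
Unset Strict Implicit.
Unset Printing Implicit Defensive.

Import GRing.Theory.
Local Open Scope ring_scope.

Lemma setU1_id (T : finType) (x : T) (A : {set T}) : x \in A -> x |: A = A.
Proof. by move=> xA; apply/setUidPr; rewrite sub1set. Qed.

(** * Order and cancellation in an idempotent semifield *)

Section Semifield.
Variables (S : comNzSemiRingType) (hS : idempotent_semifield S).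
Implicit Types a b c : S.

Local Notation "a ≤ b" := (semifield_le a b) (at level 70).

Lemma sle_refl a : a ≤ a. Proof. exact: hS.2. Qed.

Lemma sle_trans a b c : a ≤ b -> b ≤ c -> a ≤ c.
Proof. by rewrite /semifield_le => ab bc; rewrite -bc addrA ab. Qed.

Lemma sle_anti a b : a ≤ b -> b ≤ a -> a = b.
Proof. by rewrite /semifield_le => ab ba; rewrite -ba addrC. Qed.

Lemma sle0 a : 0 ≤ a. Proof. exact: add0r. Qed.

Lemma sle0_eq a : a ≤ 0 -> a = 0.
Proof. by rewrite /semifield_le addr0. Qed.

Lemma sle_mul2l c a b : a ≤ b -> c * a ≤ c * b.
Proof. by rewrite /semifield_le -mulrDr => ->. Qed.

Lemma smulfI c a b : c != 0 -> c * a = c * b -> a = b.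
Proof.
move=> /(hS.1) [t ct] /(congr1 ( *%R t)).
by rewrite !mulrA (mulrC t) ct !mul1r.
Qed.

Lemma sle_pmul2l c a b : c != 0 -> c * a ≤ c * b -> a ≤ b.
Proof. by rewrite /semifield_le -mulrDr => c0 /(smulfI c0). Qed.

Lemma smulf_neq0 a b : a != 0 -> b != 0 -> a * b != 0.
Proof.
move=> a0 b0; apply/eqP => ab0; move/eqP: b0; apply.
by apply: (smulfI a0); rewrite ab0 mulr0.
Qed.

Lemma sprodf_neq0 (I : finType) (P : pred I) (F : I -> S) :
  (forall i, P i -> F i != 0) -> \prod_(i | P i) F i != 0.
Proof.
move=> F0; apply: (big_ind (fun x => x != 0)) => //; first exact: oner_neq0.
by move=> *; exact: smulf_neq0.
Qed.

Section Sums.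
Variables (I : finType) (P : pred I).
Implicit Types F : I -> S.

Lemma sle_sum_sup F i : P i -> F i ≤ \sum_(k | P k) F k.
Proof.
by move=> Pi; rewrite (bigD1 i) //= /semifield_le addrA hS.2.
Qed.

Lemma sum_sle F b : (forall i, P i -> F i ≤ b) -> \sum_(i | P i) F i ≤ b.
Proof.
move=> Fb; apply: (big_ind (fun x => x ≤ b)) => //; first exact: sle0.
by move=> x y xb yb; rewrite /semifield_le -addrA yb.
Qed.

(** Each term lies below the sum, and only 0 lies below 0. *)
Lemma ssum_eq0 F : \sum_(k | P k) F k = 0 -> forall i, P i -> F i = 0.
Proof. by move=> F0 i /(sle_sum_sup F); rewrite F0 => /sle0_eq. Qed.

Lemma ssum_neq0 F : \sum_(k | P k) F k != 0 -> exists2 i, P i & F i != 0.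
Proof.
move=> s0; apply: contrapT => H; move/eqP: s0; apply.
apply: big1 => i Pi; apply: contrapT => /eqP Fi; apply: H; by exists i.
Qed.

(** In a total order addition is the maximum of its two arguments. *)
Lemma ssum_attained F : totally_ordered S -> \sum_(k | P k) F k != 0 ->
  exists2 i, P i & F i = \sum_(k | P k) F k.
Proof.
move=> tot.
apply: (big_ind (fun x => x != 0 -> exists2 i, P i & F i = x)) => //.
- by rewrite eqxx.
- move=> x y Hx Hy; case: (tot x y) => xy.
    by rewrite xy.
  by rewrite addrC xy.
- by move=> i Pi _; exists i.
Qed.

End Sums.

(** * Tropically vanishing families *)

Section Vanishing.
Variable n : nat.
Implicit Types t : 'I_n -> S.

(** The condition of [trop_hyperplane a] at [p], as a property of the family of terms [a i * p i],
    so that families can be rescaled and permuted. *)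
Definition trop_vanishing t := forall j, \sum_i t i = \sum_(i | i != j) t i.

Lemma trop_vanishingP t :
  trop_vanishing t <-> forall j, t j ≤ \sum_(i | i != j) t i.
Proof.
split=> vt j; first by rewrite -vt; exact: sle_sum_sup.
by rewrite (bigD1 j) //=; exact: vt.
Qed.

Lemma trop_vanishingZ c t :
  c != 0 -> trop_vanishing (fun i => c * t i) <-> trop_vanishing t.
Proof.
move=> c0; split=> vt j; last by rewrite -!mulr_sumr (vt j).
by apply: (smulfI c0); rewrite !mulr_sumr; exact: vt.
Qed.

Lemma trop_vanishing_perm (s : 'S_n) t :
  trop_vanishing t -> trop_vanishing (t \o s).
Proof.
move=> vt j; have := vt (s j).
rewrite (reindex_inj (@perm_inj _ s)) /= => ->.
rewrite (reindex_inj (@perm_inj _ s)) /=.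
by apply: eq_bigl => i; rewrite (inj_eq perm_inj).
Qed.

Lemma trop_vanishing_max t j : totally_ordered S -> trop_vanishing t ->
  t j != 0 -> (forall i, t i ≤ t j) -> exists2 i, i != j & t i = t j.
Proof.
move=> tot vt tj0 tmax.
have E : \sum_(i | i != j) t i = t j.
  by apply: sle_anti; [exact: sum_sle | exact: (proj1 (trop_vanishingP t) vt)].
have := @ssum_attained _ (fun i => i != j) t tot; rewrite E; exact.
Qed.

End Vanishing.

(** * Circuits and cocircuits of a tropical Plücker vector *)

Section Duality.
Variables (n d : nat) (v : {ffun {set 'I_n} -> S}).
Hypothesis tot : totally_ordered S.
Hypothesis pv : plucker_vector d v.

(** Coordinate form of membership in [trop_linear_space_of d v]. *)
Definition plucker_circuits (p : 'I_n -> S) := forall A : {set 'I_n},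
  #|A| = d.+1 -> trop_vanishing (fun i => (if i \in A then v (A :\ i) else 0) * p i).

(** Only terms with [i] in [A :\: B] survive: for [i] in [B] the set [i |: B] is [B], too small to
    carry a nonzero coefficient. What is left is the Plücker relation for [A] and [B]. *)
Lemma cocircuit_in_trop_linear_space (B : {set 'I_n}) :
  #|B|.+1 = d -> plucker_circuits (fun i => v (i |: B)).
Proof.
case: pv => dv _ rel dB A dA.
set t := fun i => _.
have t0 i : i \notin A :\: B -> t i = 0.
  rewrite /t inE negb_and negbK => /orP [iB|/negbTE ->]; last by rewrite mul0r.
  by rewrite setU1_id // (dv B) ?mulr0 // -dB; apply/n_Sn.
have tE i : i \in A :\: B -> t i = v (A :\ i) * v (i |: B).
  by rewrite /t inE => /andP[_ ->].
have restrict (D : {set 'I_n}) (Q : pred 'I_n) : D \subset A :\: B ->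
    (forall i, Q i && (i \in A :\: B) = (i \in D)) ->
    \sum_(i | Q i) t i = \sum_(i in D) v (A :\ i) * v (i |: B).
  move=> /subsetP sD QD.
  rewrite (bigID (mem (A :\: B))) /= [X in _ + X]big1 ?addr0; last first.
    by move=> i /andP[_ /t0].
  by apply: eq_big => // i; rewrite QD => /sD /tE.
move=> j; case: (boolP (j \in A :\: B)) => jAB; last first.
  by rewrite (bigD1 j) //= t0 // add0r.
rewrite (restrict (A :\: B)) // (rel A B j) // (restrict (A :\: B :\ j)) ?subD1set //.
by move=> i; rewrite [RHS]inE in_set1.
Qed.

(* B is I minus j, where I is a basis containing j that maximizes first the
   number of zeros of p in I and then v_I / prod_{l in I} p_l over the support
   of p (F is this weight times the product of all nonzero p_l, which avoids
   inverses).  If j is not in a maximal I, the hyperplane of T_v given by I u j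
   yields another maximal basis, which does contain j. *)
Lemma cocircuit_below (p : 'I_n -> S) (j : 'I_n) :
  plucker_circuits p -> p j != 0 ->
  exists B : {set 'I_n}, [/\ #|B|.+1 = d, v (j |: B) != 0 &
    forall i, p j * v (i |: B) ≤ v (j |: B) * p i].
Proof.
move=> vp pj0; case: pv => dv [I0 vI0] _.
have cardv I : v I != 0 -> #|I| = d.
  by move=> vI; apply: contrapT => /dv /eqP; rewrite (negbTE vI).
pose Z := [set i | p i == 0].
case: (@arg_maxnP _ I0 (fun I => v I != 0) (fun I : {set 'I_n} => #|I :&: Z|) vI0) => K vK Kmax.
pose k := #|K :&: Z|.
pose F I := if (v I != 0) && (#|I :&: Z| == k)
            then v I * \prod_(l in ~: (I :|: Z)) p l else 0.
have pZ (J : {set 'I_n}) : \prod_(l in ~: (J :|: Z)) p l != 0.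
  by apply: sprodf_neq0 => l; rewrite !inE negb_or => /andP[].
have F0 I : F I != 0 -> v I != 0 /\ #|I :&: Z| = k.
  by rewrite /F; case: ifP => [/andP[? /eqP]|]; rewrite ?eqxx.
pose m := \sum_I F I.
have Fm I : F I ≤ m by exact: sle_sum_sup.
have m0 : m != 0.
  apply/eqP => /ssum_eq0 /(_ K isT) /eqP; apply/negP.
  by rewrite /F vK eqxx; exact: smulf_neq0.
have [I [FI jI]] : exists I, F I = m /\ j \in I.
  have [I _ FI] := ssum_attained tot m0.
  have [jI|jI] := boolP (j \in I); first by exists I.
  have [vI kI] : v I != 0 /\ #|I :&: Z| = k by apply: F0; rewrite FI.
  pose A := j |: I; pose P := \prod_(l in ~: (A :|: Z)) p l.
  (* The factor [P] turns the circuit terms into weights: deleting [i] from [A] adds exactly the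
     factor [p i] to the product, so the term at [i] is [F (A :\ i)] when [i] is in [A] and [p i] is
     nonzero. *)
  pose t i := P * ((if i \in A then v (A :\ i) else 0) * p i).
  have vt : trop_vanishing t.
    by apply/(trop_vanishingZ _ (pZ A))/vp; rewrite cardsU1 jI (cardv _ vI).
  have kA : #|A :&: Z| = k.
    rewrite -kI; congr #|pred_of_set _|; apply/setP => l; rewrite !inE.
    by case: eqVneq => // ->; rewrite (negbTE pj0) !andbF.
  have tF i : i \in A -> p i != 0 -> t i = F (A :\ i).
    move=> iA pi0; rewrite /t iA /F.
    have -> : #|(A :\ i) :&: Z| = k.
      rewrite -kA; congr #|pred_of_set _|; apply/setP => l; rewrite !inE.
      by case: eqVneq => // ->; rewrite (negbTE pi0) !andbF.
    case: eqVneq => [->|_ /=]; first by rewrite mul0r mulr0.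
    have -> : ~: ((A :\ i) :|: Z) = i |: ~: (A :|: Z).
      apply/setP => l; rewrite !inE.
      by case: eqVneq => // ->; rewrite (negbTE pi0).
    rewrite eqxx big_setU1 /=; last by rewrite in_setC in_setU iA.
    by rewrite -/P mulrC -mulrA.
  have tj : t j = m.
    by rewrite tF ?setU11 // setU1K.
  have t0 i : t i != 0 -> i \in A /\ p i != 0.
    rewrite /t; case: ifP => _; last by rewrite mul0r mulr0 eqxx.
    by case: (eqVneq (p i) 0) => // ->; rewrite !mulr0 eqxx.
  (* The term at [j] is the maximum [m], so a second index [i] attains it, and [A :\ i] still
     contains [j]. *)
  have [||i ij ti] := trop_vanishing_max (j := j) tot vt; rewrite ?tj //.
    move=> i; have [->|] := eqVneq (t i) 0; first exact: sle0.
    by move=> /t0 [iA pi]; rewrite tF.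
  have [iA pi] : i \in A /\ p i != 0 by apply: t0; rewrite ti tj.
  exists (A :\ i); rewrite -tF // ti; split=> //.
  by rewrite !inE eq_sym ij eqxx.
have [vI kI] : v I != 0 /\ #|I :&: Z| = k by apply: F0; rewrite FI.
pose B := I :\ j.
have dB : #|B|.+1 = d by rewrite -(cardv _ vI) (cardsD1 j I) jI.
exists B; rewrite [j |: B]setD1K //; split=> // i.
have [->|viB] := eqVneq (v (i |: B)) 0; first by rewrite mulr0; exact: sle0.
have [->|ij] := eqVneq i j.
  by rewrite [j |: B]setD1K // mulrC; exact: sle_refl.
have iB : i \notin B.
  apply/negP => iB; have := cardv _ viB; rewrite setU1_id // -dB.
  exact: n_Sn.
have iI : i \notin I by move: iB; rewrite !inE ij.
have kB : #|B :&: Z| = k.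
  rewrite -kI; congr #|pred_of_set _|; apply/setP => l; rewrite !inE.
  by case: eqVneq => // ->; rewrite (negbTE pj0) !andbF.
(* Otherwise [i |: B] would have [k.+1] zeros of [p], against the choice of [K]. *)
have pi0 : p i != 0.
  apply/eqP => pi0; have := Kmax _ viB.
  have -> : (i |: B) :&: Z = i |: (B :&: Z).
    by rewrite setIUl; congr (_ :|: _); apply/setIidPl; rewrite sub1set inE pi0 eqxx.
  by rewrite cardsU1 inE (negbTE iB) kB /= -/k ltnn.
pose Q := \prod_(l in ~: ((i |: I) :|: Z)) p l.
have FIE : F I = v I * (p i * Q).
  rewrite /F vI kI eqxx /=.
  have -> : ~: (I :|: Z) = i |: ~: ((i |: I) :|: Z).
    apply/setP => l; rewrite !inE.
    by case: (eqVneq l i) => // ->; rewrite (negbTE pi0) (negbTE iI).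
  by rewrite big_setU1 // !inE eqxx.
have FBE : F (i |: B) = v (i |: B) * (p j * Q).
  rewrite /F viB setIUl (_ : [set i] :&: Z = set0); last first.
    by apply/setP => l; rewrite !inE; case: (eqVneq l i) => // ->; rewrite (negbTE pi0).
  rewrite set0U kB eqxx /=.
  have -> : ~: ((i |: B) :|: Z) = j |: ~: ((i |: I) :|: Z).
    apply/setP => l; rewrite !inE.
    by case: (eqVneq l j) => // ->; rewrite (negbTE pj0) eq_sym (negbTE ij).
  by rewrite big_setU1 // !inE jI orbT.
(* After multiplication by the common factor [Q], the claim reads [F (i |: B)] ≤ [F I], and [F I] is
   the maximum [m]. *)
apply: (sle_pmul2l (pZ (i |: I))); rewrite -/Q.
have QC a b : Q * (a * b) = a * (b * Q) by rewrite mulrC -mulrA.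
by rewrite (mulrC (p j)) !QC -FBE -FIE FI.
Qed.

Lemma orthogonal_cocircuits (q : 'I_n -> S) :
  (forall p, plucker_circuits p -> trop_vanishing (fun i => p i * q i)) <->
  (forall B : {set 'I_n}, #|B|.+1 = d ->
     trop_vanishing (fun i => v (i |: B) * q i)).
Proof.
split=> [H B dB|H p vp].
  exact: (H (fun i => v (i |: B))) (cocircuit_in_trop_linear_space dB).
apply/trop_vanishingP => j.
have [->|pj0] := eqVneq (p j) 0; first by rewrite mul0r; exact: sle0.
have [B [dB vI0 Bp]] := cocircuit_below vp pj0.
(* Scaled by [v (j |: B)], the term at [j] is [p j] times a cocircuit term. The cocircuit bounds it
   by its other terms, and [Bp] bounds those by the terms of [p]. *)
apply: (sle_pmul2l vI0); rewrite mulrA (mulrC _ (p j)) -mulrA.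
apply: sle_trans (sle_mul2l (p j) (proj1 (trop_vanishingP _) (H B dB) j)) _.
rewrite !mulr_sumr; apply: sum_sle => i ij.
apply: (@sle_trans _ (v (j |: B) * (p i * q i))); last first.
  exact: (@sle_sum_sup _ _ (fun i => v (j |: B) * (p i * q i))).
by rewrite !mulrA !(mulrC _ (q i)); exact: sle_mul2l.
Qed.

(** Keeps the natural subtraction [n - d] from truncating. *)
Lemma plucker_card_le : (d <= n)%N.
Proof.
case: pv => dv [I vI] _; rewrite -[n]card_ord.
suff <- : #|I| = d by exact: max_card.
by apply: contrapT => /dv /eqP; rewrite (negbTE vI).
Qed.

(** * The dual Plücker vector, rescaled by a diagonal form *)

Section ScaledDual.
Variable delta : 'I_n -> S.
Hypothesis delta0 : forall i, delta i != 0.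

Definition scaled_dual : {ffun {set 'I_n} -> S} :=
  [ffun I => v (~: I) * \prod_(i in ~: I) delta i].

(** Complementation turns the relation for [A] and [B] into the relation of [v] for [~: B] and
    [~: A]. Each term acquires the same factor, the product of [delta] over [~: A] times that over
    [~: B]. *)
Lemma plucker_scaled_dual : plucker_vector (n - d) scaled_dual.
Proof.
have dn := plucker_card_le.
have cC (I : {set 'I_n}) : (#|I| + #|~: I|)%N = n by rewrite cardsC card_ord.
case: pv => dv [I0 vI0] rel; split.
- move=> I dI; rewrite ffunE dv ?mul0r //; have := cC I; lia.
- exists (~: I0); rewrite ffunE setCK; apply: smulf_neq0 => //.
  exact: sprodf_neq0.
move=> A B j dA dB jAB.
have term i : i \in A :\: B -> scaled_dual (A :\ i) * scaled_dual (i |: B) =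
    (\prod_(l in ~: A) delta l * \prod_(l in ~: B) delta l) *
    (v (~: B :\ i) * v (i |: ~: A)).
  rewrite inE => /andP[iB iA]; rewrite !ffunE.
  have -> : ~: (A :\ i) = i |: ~: A by rewrite setDE setCI setCK setUC.
  have -> : ~: (i |: B) = ~: B :\ i by rewrite setCU setIC -setDE.
  rewrite big_setU1 ?inE ?iA //= (big_setD1 i (A := ~: B)) ?inE //=.
  set a := \prod_(_ in _) _; set b := \prod_(_ in _) _.
  ring.
have AB : A :\: B = ~: B :\: ~: A by rewrite !setDE setCK setIC.
rewrite (eq_bigr _ term) (eq_bigr _ (fun i H => term i (subsetP (subD1set _ j) i H))).
rewrite -!mulr_sumr AB (rel _ _ j) //.
- by have := cC B; lia.
- by have := cC A; lia.
- by rewrite -AB.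
Qed.

(** With [A] = [~: B], a circuit of the dual vector is the cocircuit of [v] at [B], with [delta i]
    moved onto [w i], times the cancellable product of [delta] over [B]. *)
Lemma scaled_dual_circuits (w : 'I_n -> S) :
  (forall A : {set 'I_n}, #|A| = (n - d).+1 ->
     trop_vanishing (fun i => (if i \in A then scaled_dual (A :\ i) else 0) * w i)) <->
  (forall B : {set 'I_n}, #|B|.+1 = d ->
     trop_vanishing (fun i => v (i |: B) * (delta i * w i))).
Proof.
have dn := plucker_card_le; case: (pv) => dv _ _.
have cC (I : {set 'I_n}) : (#|I| + #|~: I|)%N = n by rewrite cardsC card_ord.
have term (B : {set 'I_n}) : #|B|.+1 = d ->
    (fun i => (if i \in ~: B then scaled_dual (~: B :\ i) else 0) * w i) =
    (fun i => \prod_(l in B) delta l * (v (i |: B) * (delta i * w i))).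
  move=> dB; apply: funext => i; rewrite ffunE inE.
  have -> : ~: (~: B :\ i) = i |: B by rewrite setDE setCI !setCK setUC.
  case: (boolP (i \in B)) => iB /=.
    rewrite setU1_id // dv ?mul0r ?mulr0 //; lia.
  by rewrite big_setU1 //=; ring.
have P0 (B : {set 'I_n}) : \prod_(l in B) delta l != 0 by exact: sprodf_neq0.
split=> H B dB.
  apply/(trop_vanishingZ _ (P0 B)); rewrite -term //; apply: H.
  by have := cC B; lia.
rewrite -[B]setCK.
have dC : #|~: B|.+1 = d by have := cC B; lia.
by rewrite term //; apply/(trop_vanishingZ _ (P0 _)); exact: H.
Qed.

End ScaledDual.

End Duality.

End Semifield.

(** * Invertible matrices and extensionality of linear forms *)

(** The diagonal entry 1 of the product yields some [k] with [a i k] and [b k i] nonzero.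
    Off-diagonal zeros are sums of zero terms, so [b k j] = 0 for every other [j]. Hence [k]
    determines [i], and [i] ↦ [k] is a permutation. *)
Lemma invertible_monomial (S : comNzSemiRingType) (hS : idempotent_semifield S)
    (n : nat) (a b : 'I_n -> 'I_n -> S) :
  (forall i j, \sum_k a i k * b k j = (i == j)%:R) ->
  exists s : 'S_n, forall i, b (s i) i != 0 /\ forall j, j != i -> b (s i) j = 0.
Proof.
move=> ab.
have /fin_all_exists [f Hf] : forall i, exists k, b k i != 0 /\ forall j, j != i -> b k j = 0.
  move=> i; have := ab i i; rewrite eqxx => abi.
  have [|k _ abk] := @ssum_neq0 _ _ predT (fun k => a i k * b k i).
    by rewrite abi; exact: oner_neq0.
  have aik : a i k != 0 by apply: contraNneq abk => ->; rewrite mul0r.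
  exists k; split=> [|j ji].
    by apply: contraNneq abk => ->; rewrite mulr0.
  have := ab i j; rewrite eq_sym (negbTE ji) => /(ssum_eq0 hS) /(_ k isT) abkj.
  by apply: (smulfI hS aik); rewrite abkj mulr0.
have f_inj : injective f.
  move=> i j fij; apply/eqP; apply: contraT => ij.
  by have := (Hf j).1; rewrite -fij (Hf i).2 ?eqxx // eq_sym.
by exists (perm f_inj) => i; rewrite permE.
Qed.

Lemma scalar_ext (S : comNzSemiRingType) (V : lSemiModType S) (f g : {scalar V}) :
  f =1 g -> f = g.
Proof.
case: f g => [f [[F0] [FZ]]] [g [[G0] [GZ]]] /= /funext fg.
by subst g; rewrite (Prop_irrelevance F0 G0) (Prop_irrelevance FZ GZ).
Qed.

(** * Coordinates in a basis *)

Section Coordinates.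
Variables (S : comNzSemiRingType) (V : lSemiModType S) (n : nat).
Variables (e : 'I_n -> V) (he : is_basis e).
Local Notation coord := (basis_coord e).

Lemma basis_coordK v : v = \sum_i coord v i *: e i.
Proof.
have [c [vc _]] := he v.
pose sol : set {ffun 'I_n -> S} := fun c => v = \sum_i c i *: e i.
exact: (@xgetPex _ [ffun=> 0] sol (ex_intro _ c vc)).
Qed.

Lemma coord_sum (c : 'I_n -> S) i : coord (\sum_i c i *: e i) i = c i.
Proof.
set v := \sum_i _; have [c' [_ uniq_c]] := he v.
have vc : v = \sum_i [ffun i => c i] i *: e i.
  by apply: eq_bigr => k _; rewrite ffunE.
by rewrite -(uniq_c _ (basis_coordK v)) (uniq_c _ vc) ffunE.
Qed.

Lemma coord_basis i k : coord (e i) k = (i == k)%:R.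
Proof.
rewrite [X in coord X](_ : _ = \sum_k (i == k)%:R *: e k) ?coord_sum //.
rewrite (bigD1 i) //= eqxx scale1r big1 ?addr0 // => j.
by rewrite eq_sym => /negbTE ->; rewrite scale0r.
Qed.

Lemma coord_scale a v i : coord (a *: v) i = a * coord v i.
Proof.
rewrite {1}[v]basis_coordK scaler_sumr.
by under eq_bigr do rewrite scalerA; rewrite coord_sum.
Qed.

Lemma coord_add v w i : coord (v + w) i = coord v i + coord w i.
Proof.
rewrite {1}[v]basis_coordK {1}[w]basis_coordK -big_split /=.
by under eq_bigr do rewrite -scalerDl; rewrite coord_sum.
Qed.

Lemma coord_linear (f : {linear V -> V}) v k :
  coord (f v) k = \sum_i coord v i * coord (f (e i)) k.
Proof.
rewrite -[RHS](coord_sum (fun k => \sum_i coord v i * coord (f (e i)) k)).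
congr (coord _ k); rewrite {1}[v]basis_coordK linear_sum /=.
rewrite (eq_bigr (fun i => \sum_l (coord v i * coord (f (e i)) l) *: e l)).
  by rewrite exchange_big /=; apply: eq_bigr => l _; rewrite scaler_suml.
move=> i _; rewrite linearZ /= {1}[f (e i)]basis_coordK scaler_sumr.
by apply: eq_bigr => l _; rewrite scalerA.
Qed.

(** * Diagonal bilinear forms *)

Section DiagonalForm.
Variable delta : 'I_n -> S.

Definition diagonal_form (v w : V) : S := \sum_i delta i * (coord v i * coord w i).

Lemma diagonal_form_linear v : semiscalar (diagonal_form v).
Proof.
split=> [a w|w w']; rewrite /diagonal_form ?mulr_sumr -?big_split /=.
  by apply: eq_bigr => i _; rewrite coord_scale; ring.
by apply: eq_bigr => i _; rewrite coord_add; ring.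
Qed.

Lemma diagonal_formC v w : diagonal_form v w = diagonal_form w v.
Proof. by apply: eq_bigr => i _; rewrite (mulrC (coord v i)). Qed.

Lemma diagonal_form_linear_l w : semiscalar (diagonal_form^~ w).
Proof.
split=> [a v|v v'] /=; rewrite !(diagonal_formC _ w); apply diagonal_form_linear.
Qed.

Lemma diagonal_form_basis v i : diagonal_form v (e i) = delta i * coord v i.
Proof.
rewrite /diagonal_form (bigD1 i) //= coord_basis eqxx mulr1 big1 ?addr0 //.
by move=> k /negbTE ki; rewrite coord_basis eq_sym ki !mulr0.
Qed.

Definition diagonal_bilinear :=
  BilinearForm diagonal_form_linear diagonal_form_linear_l.

Lemma diagonal_nondegenerate : idempotent_semifield S ->
  (forall i, delta i != 0) -> form_nondegenerate diagonal_bilinear.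
Proof.
move=> [inv _] delta0.
have /fin_all_exists [t dt] i : exists t, delta i * t = 1 by exact: inv.
(* The form sends [v] to the linear form with values [delta i * coord v i] on the basis; dividing by
   [delta i] through [t i] inverts this. *)
exists (fun f : {scalar V} => \sum_i (t i * f (e i)) *: e i) => [v|f].
  rewrite [RHS]basis_coordK; apply: eq_bigr => i _.
  by rewrite /induced_map /= diagonal_form_basis mulrA (mulrC (t i)) dt mul1r.
apply: scalar_ext => w /=; rewrite [w in RHS]basis_coordK linear_sum /=.
apply: eq_bigr => i _.
by rewrite linearZ /= coord_sum [RHS]mulrC -[f (e i) in RHS]mul1r -(dt i); ring.
Qed.

End DiagonalForm.

(** * The averaged form and its invariance *)

Section Averaging.
Hypothesis hS : idempotent_semifield S.
Variables (G : finGroupType) (rho : G -> {linear V -> V}).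
Hypothesis hrho : is_representation rho.

Lemma representation_monomial g : exists s : 'S_n, exists c : 'I_n -> S,
  forall i, c i != 0 /\ forall v, coord (rho g v) i = c i * coord v (s i).
Proof.
pose M g i k := coord (rho g (e i)) k.
have MM i j : \sum_k M g^-1%g i k * M g k j = (i == j)%:R.
  rewrite -coord_linear -hrho.2 mulgV hrho.1; exact: coord_basis.
have [s Hs] := invertible_monomial hS MM.
exists s, (fun i => M g (s i) i) => i; split=> [|v]; first exact: (Hs i).1.
rewrite coord_linear (bigD1 (s i)) //= mulrC big1 ?addr0 // => k.
rewrite -[k](permKV s) (inj_eq perm_inj) => ki.
by rewrite -/(M _ _ _) (Hs _).2 ?mulr0 // eq_sym.
Qed.

Lemma averaged_innerE : exists2 delta : 'I_n -> S, forall i, delta i != 0 &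
  forall v w, averaged_inner e rho v w = diagonal_form delta v w.
Proof.
have /fin_all_exists [s /fin_all_exists [c Hc]] := representation_monomial.
(* The summand of [g] is the sum over [i] of [c g i ^+ 2] times the coordinates at [s g i];
   reindexing by [s g] gives these coefficients. They are nonzero because the summand at [g] = 1
   is. *)
exists (fun i => \sum_g c g ((s g)^-1%g i) ^+ 2) => [i|v w].
  apply/eqP => /(ssum_eq0 hS) /(_ 1%g isT) /eqP.
  by apply/negP; apply: (smulf_neq0 hS); exact: (Hc _ _).1.
rewrite /averaged_inner /diagonal_form.
under [RHS]eq_bigr do rewrite mulr_suml.
rewrite [RHS]exchange_big /=; apply: eq_bigr => g _.
rewrite (reindex_inj (@perm_inj _ (s g))) /=; apply: eq_bigr => i _.
by rewrite permK !(Hc _ _).2; ring.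
Qed.

Lemma averaged_inner_invariant h v w :
  averaged_inner e rho (rho h v) (rho h w) = averaged_inner e rho v w.
Proof.
rewrite [RHS](reindex_inj (mulIg h)) /=.
by apply: eq_bigr => g _; rewrite !hrho.2.
Qed.

(** Tropical vanishing depends on individual terms, so invariance of the total sum does not suffice:
    [g] must permute the summands of the form. *)
Lemma representation_isometry (delta : 'I_n -> S) g :
  (forall v w, averaged_inner e rho v w = diagonal_form delta v w) ->
  exists s : 'S_n, forall v w i,
    delta i * (coord (rho g v) i * coord (rho g w) i) =
    delta (s i) * (coord v (s i) * coord w (s i)).
Proof.
move=> avg; have [s [c Hc]] := representation_monomial g.
exists s => v w i; rewrite !(Hc i).2.
suff <- : delta i * c i ^+ 2 = delta (s i) by ring.
(* [rho g] maps [e (s i)] to [c i *: e i], so invariance on this vector compares exactly the two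
   coefficients wanted. *)
have := averaged_inner_invariant g (e (s i)) (e (s i)).
rewrite !avg diagonal_form_basis coord_basis eqxx mulr1 => <-.
rewrite /diagonal_form (bigD1 i) //= big1 ?addr0 => [|k ki].
  by rewrite (Hc i).2 coord_basis eqxx mulr1.
by rewrite (Hc k).2 coord_basis (inj_eq perm_inj) eq_sym (negbTE ki) !mulr0.
Qed.

End Averaging.

End Coordinates.

Local Open Scope classical_set_scope.
Local Open Scope ring_scope.

(** * Non-degeneracy of the averaged form and the dual subrepresentation *)

Theorem theorem3p3p3 (S : comNzSemiRingType) (hS : idempotent_semifield S)
    (n : nat) (V : lSemiModType S) (e : 'I_n -> V) (he : is_basis e)
    (G : finGroupType) (rho : G -> {linear V -> V})
    (hrho : is_representation rho) :
  exists B : bilinear_form V,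
    [/\ forall v w, B v w = averaged_inner e rho v w,
        form_symmetric B,
        form_nondegenerate B &
        totally_ordered S ->
        forall T : set V, trop_subrepresentation e rho T ->
        forall psi : {scalar V} -> V,
          cancel (induced_map B) psi -> cancel psi (induced_map B) ->
          trop_subrepresentation e rho (psi @` orthogonal_dual e T)].
Proof.
have [delta delta0 avg] := averaged_innerE he hS hrho.
pose B := diagonal_bilinear he delta; exists B.
split; first by move=> v w; rewrite avg.
- exact: diagonal_formC.
- exact: diagonal_nondegenerate.
move=> tot T [[d [v [pv ->]]] Tinv] psi psiK Kpsi.
set Tv := trop_linear_space_of e d v.
(* The only linear form that [psi] sends to [w] is [induced_map B w], with dual coordinates
   [delta i * basis_coord e w i]. *)
have memD w : (psi @` orthogonal_dual e Tv) w <-> forall p, Tv p ->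
    trop_vanishing (fun i => delta i * (basis_coord e p i * basis_coord e w i)).
  have Bw i : induced_map B w (e i) = delta i * basis_coord e w i.
    exact: diagonal_form_basis.
  have E p : (fun i => delta i * (basis_coord e p i * basis_coord e w i)) =
      (fun i => basis_coord e p i * induced_map B w (e i)).
    by apply: funext => i; rewrite Bw; ring.
  split=> [[f fT fw] p Tp|H].
    by rewrite E -fw Kpsi; exact: fT.
  by exists (induced_map B w) => // p /H; rewrite E.
split; last first.
  move=> g w /memD Dw; apply/memD => p Tp.
  have [s gE] := representation_isometry he hS hrho g avg.
  (* The terms for [p] and [rho g w] are thus a permutation of those for [rho g^-1 p] and [w], and
     [rho g^-1 p] again lies in the invariant [Tv]. *)
  have -> : p = rho g (rho g^-1%g p) by rewrite -hrho.2 mulgV hrho.1.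
  under eq_fun do rewrite gE.
  apply: (trop_vanishing_perm s (Dw _ _)).
  exact: Tinv.
exists (n - d)%N, (scaled_dual v delta).
split; first exact: plucker_scaled_dual.
have dualE w : (psi @` orthogonal_dual e Tv) w <->
    trop_linear_space_of e (n - d) (scaled_dual v delta) w.
  apply: (iff_trans (memD w)); apply: iff_trans; last first.
    exact: (iff_sym (scaled_dual_circuits hS pv delta0 (basis_coord e w))).
  apply: iff_trans (orthogonal_cocircuits hS tot pv _).
  have mulE p : (fun i => p i * (delta i * basis_coord e w i)) =
      (fun i => delta i * (p i * basis_coord e w i)).
    by apply: funext => i; ring.
  split=> H p vp; last by rewrite -mulE; exact: H.
  (* Every function [p] is the coordinate vector of a point of [V], so a condition on all points of
     [Tv] covers all [p] satisfying [plucker_circuits]. *)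
  have pE : p = basis_coord e (\sum_i p i *: e i).
    by apply: funext => i; rewrite coord_sum.
  by rewrite mulE {}pE in vp *; exact: H.
by apply/seteqP; split => w /dualE.
Qed.
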